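(* Let $B_0\colon\ell^2\to X$ be an injective bounded linear operator with $\|B_0\|_{\mathcal{L}(\ell^2,X)}\le1$. Let $E\in\mathcal{L}(\ell^2)$ be a compact positive operator with $\|E\|_{\mathcal{L}(\ell^2)}\le 1$ whose eigenvalues $\lambda_n$ (counted with multiplicity) satisfy $$\lambda_n\le c\,n^{-s},\qquad n\in\mathbb{N},$$ for some $c,s>0$. For every finite set $I\subset\mathbb{N}$ let $c_I>0$, and define $$\mathcal{H}=\Big\{K=ETE:\ T\in\mathcal{L}(\ell^2),\ \|T\|_{\mathcal{L}(\ell^2)}\le1,\ \text{and } \|(\operatorname{Id}+K)u\|_{\ell^2}\ge c_I\|u\|_{\ell^2}\ \text{for every finite } I\subset\mathbb{N}\text{ and } u\in\ell^2_I\Big\},$$ $$\mathcal{B}=\{B_0(\operatorname{Id}+K):\ K\in\mathcal{H}\}.$$ Take $0<s'<s$. Then there exists $C>0$ such that $$\log\mathcal{N}\big(\mathcal{B},r;\|\cdot\|_{\mathcal{L}(\ell^2,X)}\big)\le C\,r^{-\frac{2s+1}{2ss'}},\qquad r>0.$$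
   Context: $X,Y$ are real separable Hilbert spaces; standing assumption: $A\colon X\to Y$ is a bounded injective linear operator. $\ell^2=\ell^2(\mathbb{N})$ with $\mathbb{N}=\{1,2,\dots\}$ and canonical basis $(e_i)$; $\mathcal{L}(\ell^2,X)$ denotes the bounded linear operators with the operator norm, and $\mathcal{L}(\ell^2)=\mathcal{L}(\ell^2,\ell^2)$. $\ell^2_I:=\operatorname{span}\{e_i:i\in I\}$. For $r>0$, $\mathcal{N}(\mathcal{B},r;\|\cdot\|)$ is the covering number: the minimum number of balls of radius $r$ in the norm $\|\cdot\|$ whose union contains $\mathcal{B}$. *)

(* Defs.v *)
From HB Require Import structures.
From mathcomp Require Import all_boot all_order all_algebra finmap.
From mathcomp Require Import all_classical all_reals all_analysis.
From mathcomp Require Import ring lra.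

Set Implicit Arguments.
Unset Strict Implicit.
Unset Printing Implicit Defensive.

Import Order.TTheory GRing.Theory Num.Def Num.Theory.
Import numFieldNormedType.Exports.

Local Open Scope classical_set_scope.
Local Open Scope ring_scope.

HB.mixin Record NormedModule_isHilbert (R : realType) H
    & NormedModule R H := {
  inner : H -> H -> R;
  innerC : forall u v, inner u v = inner v u;
  innerDl : forall u v w, inner (u + v) w = inner u w + inner v w;
  innerZl : forall (a : R) u v, inner (a *: u) v = a * inner u v;
  inner_norm : forall u, inner u u = `|u| ^+ 2
}.

#[short(type="hilbertType")]
HB.structure Definition Hilbert (R : realType) :=
  {H of NormedModule_isHilbert R H & CompleteNormedModule R H}.

Definition separable (T : topologicalType) : Prop :=
  exists2 D : set T, countable D & dense D.

Section inner_product_norm.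
Context (R : realType) (V : lmodType R) (b : V -> V -> R).
Hypothesis bC : forall u v, b u v = b v u.
Hypothesis bDl : forall u v w, b (u + v) w = b u w + b v w.
Hypothesis bZl : forall (a : R) u v, b (a *: u) v = a * b u v.
Hypothesis b_ge0 : forall u, 0 <= b u u.

Lemma form_cauchy_schwarz u v : b u v ^+ 2 <= b u u * b v v.
Proof.
have bDr x y z : b x (y + z) = b x y + b x z by rewrite bC bDl !(bC x).
have bZr (a : R) x y : b x (a *: y) = a * b x y by rewrite bC bZl (bC x).
have key (s t : R) :
    0 <= s ^+ 2 * b u u + 2 * (s * t) * b u v + t ^+ 2 * b v v.
  have -> : s ^+ 2 * b u u + 2 * (s * t) * b u v + t ^+ 2 * b v v =
      b (s *: u + t *: v) (s *: u + t *: v); last exact: b_ge0.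
  by rewrite bDl !bDr !bZl !bZr (bC v u); ring.
have [vv0|vv0] := eqVneq (b v v) 0; last first.
  have vv_gt0 : 0 < b v v by rewrite lt_def vv0 b_ge0.
  rewrite -subr_ge0 -(pmulr_rge0 _ vv_gt0).
  have -> : b v v * (b u u * b v v - b u v ^+ 2) =
      b v v ^+ 2 * b u u + 2 * (b v v * - b u v) * b u v +
      (- b u v) ^+ 2 * b v v by ring.
  exact: key.
have /eqP -> : b u v == 0; last by rewrite expr0n/= mulr_ge0.
apply: contraT => uv0.
have := key 1 (- (b u u + 1) / (2 * b u v)).
rewrite vv0 mulr0 addr0 expr1n !mul1r.
rewrite (_ : 2 * _ * _ = - (b u u + 1)); last by field.
by rewrite opprD addrA subrr sub0r ler0N1.
Qed.

Lemma form_norm_triangle u v :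
  sqrtr (b (u + v) (u + v)) <= sqrtr (b u u) + sqrtr (b v v).
Proof.
rewrite -ler_sqr ?nnegrE ?sqrtr_ge0 ?addr_ge0 ?sqrtr_ge0//.
rewrite sqrrD !sqr_sqrtr ?b_ge0// bDl (bC u) (bC v) !bDl (bC v u).
have : b u v <= sqrtr (b u u) * sqrtr (b v v).
  rewrite -sqrtrM ?b_ge0// (le_trans (ler_norm _))// -sqrtr_sqr.
  by rewrite ler_sqrt ?mulr_ge0// form_cauchy_schwarz.
lra.
Qed.

Lemma form_norm_scale (a : R) u :
  sqrtr (b (a *: u) (a *: u)) = `|a| * sqrtr (b u u).
Proof.
by rewrite bZl bC bZl mulrA -expr2 sqrtrM ?sqr_ge0// sqrtr_sqr.
Qed.

End inner_product_norm.

(* The index set {1, 2, ...} of l^2 is represented by nat, n : nat standing for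
   n + 1. *)
Section ell2.
Context (R : realType).
Implicit Types u v : R^nat.

Definition square_summable : {pred R^nat} :=
  mem [set u : R^nat | cvgn (series (fun n => u n ^+ 2))].

Lemma square_summableP u :
  reflect (cvgn (series (fun n => u n ^+ 2))) (u \in square_summable).
Proof. exact: (iffP (asboolP _)). Qed.

Lemma square_summable_mul u v : u \in square_summable ->
  v \in square_summable -> cvgn (series (fun n => u n * v n)).
Proof.
move=> /square_summableP u2 /square_summableP v2.
apply: normed_cvg; apply: (@series_le_cvg _ _ (fun n => u n ^+ 2 + v n ^+ 2)).
- by move=> n; rewrite normr_ge0.
- by move=> n; rewrite addr_ge0// sqr_ge0.
- move=> n /=; rewrite normrM -(real_normK (num_real (u n))).
  rewrite -(real_normK (num_real (v n))).
  have := sqr_ge0 (`|u n| - `|v n|).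
  have := mulr_ge0 (normr_ge0 (u n)) (normr_ge0 (v n)).
  nra.
- by have := is_cvg_seriesD u2 v2.
Qed.

Lemma square_summable_submod : submod_closed square_summable.
Proof.
split=> [|a u v us vs].
  apply/square_summableP; rewrite (_ : series _ = cst 0); first exact: is_cvg_cst.
  by apply/funext => n; rewrite /series/= big1// => i _; rewrite expr0n.
apply/square_summableP.
have := is_cvg_seriesD (is_cvg_seriesZ (k := a ^+ 2) (square_summable_mul us us))
  (is_cvg_seriesD (is_cvg_seriesZ (k := 2 * a) (square_summable_mul us vs))
     (square_summable_mul vs vs)).
set w := (X in cvgn (series X) -> _).
suff -> : w = (fun n => (a *: u + v) n ^+ 2) by [].
by apply/funext => n; rewrite /w !fctE /GRing.scale/=; ring.
Qed.

HB.instance Definition _ :=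
  GRing.isSubmodClosed.Build R R^nat square_summable square_summable_submod.

Record ell2 := Ell2 {
  ell2_seq :> nat -> R ;
  ell2_square_summable : ell2_seq \in square_summable }.

HB.instance Definition _ := [isSub for ell2_seq].
HB.instance Definition _ := [Choice of ell2 by <:].
HB.instance Definition _ := [SubChoice_isSubLmodule of ell2 by <:].

Definition ell2_inner (f g : ell2) : R := limn (series (fun n => f n * g n)).

Implicit Types f g h : ell2.

Lemma ell2_inner_cvg f g :
  series (fun n => f n * g n) @ \oo --> ell2_inner f g.
Proof. exact: (square_summable_mul (valP f) (valP g)). Qed.

Lemma ell2_innerC f g : ell2_inner f g = ell2_inner g f.
Proof.
by congr (limn (series _)); apply/funext => n; rewrite mulrC.
Qed.

Lemma ell2_innerDl f g h :
  ell2_inner (f + g) h = ell2_inner f h + ell2_inner g h.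
Proof.
apply/cvg_lim => //.
rewrite (_ : series _ = series (fun n => f n * h n) +
                        series (fun n => g n * h n)).
  by apply: cvgD; exact: ell2_inner_cvg.
rewrite -seriesD; congr series; apply/funext => n.
by rewrite /= !fctE mulrDl.
Qed.

Lemma ell2_innerZl (a : R) f g : ell2_inner (a *: f) g = a * ell2_inner f g.
Proof.
apply/cvg_lim => //.
rewrite (_ : series _ = a *: series (fun n => f n * g n)).
  by apply: cvgZr; exact: ell2_inner_cvg.
rewrite -seriesZ; congr series; apply/funext => n.
by rewrite /= !fctE /GRing.scale/= mulrA.
Qed.

Lemma ell2_partial_sum_le f n : \sum_(i < n) f i ^+ 2 <= ell2_inner f f.
Proof.
have -> : \sum_(i < n) f i ^+ 2 = series (fun k => f k * f k) n.
  by rewrite /series/= big_mkord.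
apply: nondecreasing_cvgn_le; last exact: ell2_inner_cvg.
by apply: nondecreasing_series => k _ _; rewrite -expr2 sqr_ge0.
Qed.

Lemma ell2_inner_ge0 f : 0 <= ell2_inner f f.
Proof. by have := ell2_partial_sum_le f 0; rewrite big_ord0. Qed.

Definition ell2_norm f : R := sqrtr (ell2_inner f f).

Lemma ell2_coord_le f n : `|f n| <= ell2_norm f.
Proof.
rewrite -sqrtr_sqr ler_sqrt ?ell2_inner_ge0//.
apply: le_trans (ell2_partial_sum_le f n.+1).
by rewrite big_ord_recr/= lerDr sumr_ge0// => i _; rewrite sqr_ge0.
Qed.

Lemma ell2_normD f g : ell2_norm (f + g) <= ell2_norm f + ell2_norm g.
Proof.
exact: (form_norm_triangle ell2_innerC ell2_innerDl ell2_innerZl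
  ell2_inner_ge0).
Qed.

Lemma ell2_normZ (a : R) f : ell2_norm (a *: f) = `|a| * ell2_norm f.
Proof. exact: (form_norm_scale ell2_innerC ell2_innerZl). Qed.

Lemma ell2_norm0_eq0 f : ell2_norm f = 0 -> f = 0.
Proof.
move=> f0; apply/val_inj/funext => n /=.
by apply/eqP; rewrite -normr_le0 -f0 ell2_coord_le.
Qed.

HB.instance Definition _ :=
  Lmodule_isNormed.Build R ell2 ell2_normD ell2_normZ ell2_norm0_eq0.

Lemma ell2_inner_norm f : ell2_inner f f = `|f| ^+ 2.
Proof. by rewrite sqr_sqrtr ?ell2_inner_ge0. Qed.

Lemma ell2_norm_le f (e : R) : 0 <= e ->
  (forall n, \sum_(i < n) f i ^+ 2 <= e ^+ 2) -> `|f| <= e.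
Proof.
move=> e0 fe; rewrite -ler_sqr ?nnegrE// -ell2_inner_norm.
apply: limr_le; first exact: square_summable_mul (valP f) (valP f).
by near=> n; rewrite /series/= big_mkord fe.
Unshelve. all: by end_near. Qed.

Lemma ell2_complete (F : set_system ell2) :
  ProperFilter F -> cauchy F -> cvg F.
Proof.
move=> FF Fc.
have Fball : forall e : R, 0 < e -> exists g : ell2, F (ball g e).
  exact/cauchyP.
have coord_cvg n : exists l : R, (fun f : ell2 => f n) @ F --> l.
  suff : cvg ((fun f : ell2 => f n) @ F) by move=> ?; eexists; eassumption.
  apply/cauchy_cvgP/cauchy_exP => e e0.
  have [g Fg] := Fball e e0; exists (g n).
  suff : F [set f : ell2 | ball (g n) e (f n)] by [].
  apply: filterS Fg => f; rewrite -!ball_normE /= => gf.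
  exact: le_lt_trans (ell2_coord_le (g - f) n) gf.
have [l lP] := choice coord_cvg.
have l_close (e : R) (g : ell2) : 0 <= e -> F (ball g e) ->
    forall n, \sum_(i < n) (g i - l i) ^+ 2 <= e ^+ 2.
  move=> e0 Fg n.
  have lim_sum : (fun f : ell2 => \sum_(i < n) (g i - f i) ^+ 2) @ F -->
      \sum_(i < n) (g i - l i) ^+ 2.
    elim: n => [|n IHn].
      rewrite big_ord0 (_ : (fun _ => _) = cst 0); first exact: cvg_cst.
      by apply/funext => f; rewrite big_ord0.
    rewrite big_ord_recr/=.
    under eq_fun do rewrite big_ord_recr/=.
    apply: cvgD IHn _; rewrite expr2.
    under eq_fun do rewrite expr2.
    by apply: cvgM; apply: cvgB; [exact: cvg_cst|exact: lP|exact: cvg_cst|exact: lP].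
  rewrite -(cvg_lim _ lim_sum)//.
  apply: limr_le; first by apply/cvg_ex; exists (\sum_(i < n) (g i - l i) ^+ 2).
  apply: filterS Fg => f; rewrite -!ball_normE /= => gf.
  apply: le_trans (ell2_partial_sum_le (g - f) n) _.
  by rewrite ell2_inner_norm ler_sqr ?nnegrE// ltW.
have l_ell2 : (l : R^nat) \in square_summable.
  have [g Fg] := Fball 1 ltr01.
  have gl : (fun n => g n - l n) \in square_summable.
    apply/square_summableP; apply: nondecreasing_is_cvgn.
      by apply: nondecreasing_series => k _ _; rewrite sqr_ge0.
    exists (1 ^+ 2) => _ [n _ <-]; rewrite /series/= big_mkord.
    exact: l_close ler01 Fg n.
  rewrite (_ : l = val g - (fun n => g n - l n)).
    by rewrite rpredB// (valP g).
  by apply/funext => n; rewrite !fctE/= opprB addrC subrK.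
apply/cvg_ex; exists (Ell2 l_ell2); apply/cvgrPdist_le => e e0.
have e20 : 0 < e / 2 by rewrite divr_gt0.
have [g Fg] := Fball _ e20.
have gl : `|g - Ell2 l_ell2| <= e / 2.
  by apply: ell2_norm_le (ltW e20) _ => n; exact: l_close (ltW e20) Fg n.
apply: filterS Fg => f; rewrite -ball_normE /= => gf.
rewrite -[X in `|X|](_ : (g - f) - (g - Ell2 l_ell2) = _).
  by rewrite (le_trans (ler_normB _ _))// (splitr e) lerD// ltW.
by rewrite opprB addrC addrA subrK.
Qed.

HB.instance Definition _ := Uniform_isComplete.Build ell2 ell2_complete.

HB.instance Definition _ := NormedModule_isHilbert.Build R ell2
  ell2_innerC ell2_innerDl ell2_innerZl ell2_inner_norm.

End ell2.

Section ell2_span.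
Context (R : realType).

Lemma ell2_basis_subproof (i : nat) :
  (fun n => (n == i)%:R : R) \in @square_summable R.
Proof.
apply/square_summableP/cvg_ex; exists 1; apply: cvg_near_cst.
exists i.+1 => // n /= ltin; rewrite /series/=.
rewrite big_mkord (bigD1 (Ordinal ltin))//= eqxx expr1n big1 ?addr0// => j.
by rewrite -val_eqE/= => /negPf ->; rewrite expr0n.
Qed.

Definition ell2_basis (i : nat) : ell2 R := Ell2 (ell2_basis_subproof i).

Definition ell2_span (I : {fset nat}) : set (ell2 R) :=
  [set u | exists a : nat -> R, u = \sum_(i <- I) a i *: ell2_basis i].

End ell2_span.

Section bounded_operators.
Context (R : realType).

Definition bounded_linear (U V : normedModType R) : {pred U -> V} :=
  mem [set f : U -> V | linear f /\ exists M : R, forall x, `|f x| <= M * `|x|].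
Arguments bounded_linear : clear implicits.

Section operator_space.
Context (U V : normedModType R).

Lemma bounded_linearP (f : U -> V) :
  reflect (linear f /\ exists M : R, forall x, `|f x| <= M * `|x|)
    (f \in bounded_linear U V).
Proof. exact: (iffP (asboolP _)). Qed.

Lemma bounded_linear_submod : submod_closed (bounded_linear U V).
Proof.
split=> [|a f g /bounded_linearP[lf [M fM]] /bounded_linearP[lg [N gN]]].
  apply/bounded_linearP; split; first by move=> a x y /=; rewrite scaler0 addr0.
  by exists 0 => x /=; rewrite normr0 mul0r.
apply/bounded_linearP; split.
  move=> b x y; rewrite !fctE lf lg !scalerDr !scalerA mulrC.
  by rewrite addrACA.
exists (`|a| * M + N) => x; rewrite !fctE (le_trans (ler_normD _ _))// mulrDl.
by rewrite lerD// normrZ -mulrA ler_wpM2l.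
Qed.

HB.instance Definition _ := GRing.isSubmodClosed.Build R (U -> V)
  (bounded_linear U V) bounded_linear_submod.

Record bop := Bop {
  bop_fun :> U -> V ;
  bop_bounded_linear : bop_fun \in bounded_linear U V }.

HB.instance Definition _ := [isSub for bop_fun].
HB.instance Definition _ := [Choice of bop by <:].
HB.instance Definition _ := [SubChoice_isSubLmodule of bop by <:].

Implicit Types f g : bop.

Lemma bop_linear f : linear f.
Proof. by have /bounded_linearP[] := valP f. Qed.

HB.instance Definition _ f := GRing.isLinear.Build R U V *:%R f (bop_linear f).

Definition opnorm f : R := sup [set `|f x| | x in [set x : U | `|x| <= 1]].

Lemma opnorm_has_sup f : has_sup [set `|f x| | x in [set x : U | `|x| <= 1]].
Proof.
split; first by exists `|f 0|; exists 0 => //=; rewrite normr0.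
have /bounded_linearP[_ [M fM]] := valP f.
exists `|M| => _ [x /= x1 <-]; rewrite (le_trans (fM x))//.
by rewrite (le_trans (ler_wpM2r (normr_ge0 x) (ler_norm M)))// ler_piMr.
Qed.

Lemma opnorm_ge0 f : 0 <= opnorm f.
Proof.
rewrite -(normr0 V) -(linear0 f); apply: sup_upper_bound.
  exact: opnorm_has_sup.
by exists 0 => //=; rewrite normr0.
Qed.

Lemma bop_le f x : `|f x| <= opnorm f * `|x|.
Proof.
have [->|x0] := eqVneq x 0; first by rewrite linear0 !normr0 mulr0.
have nx0 : 0 < `|x| by rewrite normr_gt0.
rewrite -ler_pdivrMr// mulrC.
rewrite -[X in X * _](@ger0_norm _ `|x|^-1) ?invr_ge0// -normrZ -linearZ.
apply: sup_upper_bound; first exact: opnorm_has_sup.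
exists (`|x|^-1 *: x) => //=.
by rewrite normrZ ger0_norm ?invr_ge0// mulVf// gt_eqF.
Qed.

Lemma opnorm_le f (M : R) :
  (forall x, `|x| <= 1 -> `|f x| <= M) -> opnorm f <= M.
Proof.
move=> fM; apply: sup_le_ub; first exact: (opnorm_has_sup f).1.
by move=> _ [x /= x1 <-]; exact: fM.
Qed.

Lemma opnormD f g : opnorm (f + g) <= opnorm f + opnorm g.
Proof.
apply: opnorm_le => x x1; rewrite [X in `|X|]/= (le_trans (ler_normD _ _))//.
by rewrite lerD// (le_trans (bop_le _ _))// ler_piMr// opnorm_ge0.
Qed.

Lemma opnormZ_le (a : R) f : opnorm (a *: f) <= `|a| * opnorm f.
Proof.
apply: opnorm_le => x x1.
rewrite [X in `|X|](_ : _ = a *: f x)// normrZ ler_wpM2l//.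
by rewrite (le_trans (bop_le _ _))// ler_piMr// opnorm_ge0.
Qed.

Lemma opnormZ (a : R) f : opnorm (a *: f) = `|a| * opnorm f.
Proof.
apply/eqP; rewrite eq_le opnormZ_le/=.
have [->|a0] := eqVneq a 0; first by rewrite normr0 mul0r opnorm_ge0.
have := opnormZ_le a^-1 (a *: f).
by rewrite scalerA mulVf// scale1r normfV ler_pdivlMl ?normr_gt0.
Qed.

Lemma opnorm0_eq0 f : opnorm f = 0 -> f = 0.
Proof.
move=> f0; apply/val_inj/funext => x /=.
by apply/eqP; rewrite -normr_le0 (le_trans (bop_le f x))// f0 mul0r.
Qed.

HB.instance Definition _ :=
  Lmodule_isNormed.Build R bop opnormD opnormZ opnorm0_eq0.

End operator_space.

Lemma bop_comp_subproof (U V W : normedModType R) (g : bop V W) (f : bop U V) :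
  g \o f \in bounded_linear U W.
Proof.
apply/bounded_linearP; split; first by move=> a x y /=; rewrite !linearP.
exists (opnorm g * opnorm f) => x /=.
by rewrite (le_trans (bop_le _ _))// -mulrA ler_wpM2l ?opnorm_ge0 ?bop_le.
Qed.

Definition bop_comp (U V W : normedModType R) (g : bop V W) (f : bop U V) :
  bop U W := Bop (bop_comp_subproof g f).

Lemma bop_id_subproof (U : normedModType R) : @idfun U \in bounded_linear U U.
Proof.
by apply/bounded_linearP; split=> //; exists 1 => x; rewrite mul1r.
Qed.

Definition bop_id (U : normedModType R) : bop U U := Bop (bop_id_subproof U).

Definition compact_operator (U V : normedModType R) (f : bop U V) : Prop :=
  compact (closure (f @` [set x : U | `|x| <= 1])).

(* Over the reals, positivity of the quadratic form does not imply symmetry. *)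
Definition positive_operator (H : hilbertType R) (f : bop H H) : Prop :=
  (forall u v, inner (f u) v = inner u (f v)) /\
  (forall u, 0 <= inner (f u) u).

Definition lin_indep (V : lmodType R) (k : nat) (v : 'I_k -> V) : Prop :=
  forall a : 'I_k -> R, \sum_i a i *: v i = 0 -> forall i, a i = 0.

Definition multiplicity_ge (V : normedModType R) (f : bop V V) (mu : R)
    (k : nat) : Prop :=
  exists2 v : 'I_k -> V, lin_indep v & forall i, f (v i) = mu *: v i.

(* [lam] lists the nonzero eigenvalues of [f], each repeated according to its
   multiplicity, in any order; the value 0 may occur any number of times, so
   that finitely many nonzero eigenvalues can be padded with zeros. *)
Definition eigenvalue_sequence (V : normedModType R) (f : bop V V)
    (lam : nat -> R) : Prop :=
  forall (mu : R) (k : nat), mu != 0 ->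
    multiplicity_ge f mu k <->
    exists2 j : 'I_k -> nat, injective j & forall i, lam (j i) = mu.

End bounded_operators.

Section covering.
Context (R : realType) (V : normedModType R).

(* The centers need not lie in B; the value is +oo if there is no finite cover
   (an infimum of natural numbers is otherwise attained). *)
Definition covering_number (B : set V) (r : R) : \bar R :=
  ereal_inf [set (n%:R)%:E | n in
    [set n : nat | exists x : 'I_n -> V, B `<=` \bigcup_i ball (x i) r]].

End covering.

Section operator_classes.
Context (R : realType).

Definition classH (E : bop (ell2 R) (ell2 R)) (cI : {fset nat} -> R) :
    set (bop (ell2 R) (ell2 R)) :=
  [set K | exists T : bop (ell2 R) (ell2 R),
    [/\ K = bop_comp E (bop_comp T E),
        `|T| <= 1 &
        forall (I : {fset nat}) (u : ell2 R), ell2_span I u ->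
          `|(bop_id _ + K) u| >= cI I * `|u| ]].

Definition classB (X : normedModType R) (B0 : bop (ell2 R) X)
    (E : bop (ell2 R) (ell2 R)) (cI : {fset nat} -> R) :
    set (bop (ell2 R) X) :=
  [set bop_comp B0 (bop_id _ + K) | K in classH E cI].

End operator_classes.

(* Main.v *)
(* The covering only sees the operators ETE with T a contraction, so it is enough
   to cover these. Let v_0, v_1, ... be orthonormal eigenvectors of E with
   eigenvalues mu_n <= c (n+1)^(-s), and cut the index set into dyadic blocks
   2^a - 1 <= i < 2^(a+1) - 1, on the a-th of which E has norm at most c 2^(-sa).
   Keeping only the matrix entries of ETE whose row lies in block a and whose
   column lies in a block b < L - a, for a < L, changes ETE by O(L 2^(-sL)) in
   operator norm and leaves at most L 2^L entries, all in [-1, 1]. Rounding each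
   entry on a grid of 2^O(L) points yields a cover of log-cardinality O(L^2 2^L)
   and radius O(L 2^(-sL)). The factors polynomial in L are absorbed by s' < s
   and by the surplus 1/(2s) of the exponent times s', which is 1 + 1/(2s). *)

Require Import Defs.
From mathcomp Require Import all_boot all_order all_algebra finmap.
From mathcomp Require Import all_classical all_reals all_analysis.
From mathcomp Require Import ring lra zify.

Set Implicit Arguments.
Unset Strict Implicit.
Unset Printing Implicit Defensive.

Import Order.TTheory GRing.Theory Num.Def Num.Theory.
Import numFieldNormedType.Exports.

Local Open Scope classical_set_scope.
Local Open Scope ring_scope.

(** * Linearity and evaluation of bounded operators *)

Section bounded_operator_algebra.
Context (R : realType) (U V : normedModType R).
Implicit Types f g : bop U V.

Lemma bopB f x y : f (x - y) = f x - f y.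
Proof. exact: linearB. Qed.

Lemma bopZ f (a : R) x : f (a *: x) = a *: f x.
Proof. exact: linearZ. Qed.

Lemma bop_sum f I (r : seq I) (P : pred I) (F : I -> U) :
  f (\sum_(i <- r | P i) F i) = \sum_(i <- r | P i) f (F i).
Proof. exact: linear_sum. Qed.

Lemma sum_bopE I (r : seq I) (P : pred I) (F : I -> bop U V) x :
  (\sum_(i <- r | P i) F i) x = \sum_(i <- r | P i) F i x.
Proof. exact: (big_morph (fun f : bop U V => f x)). Qed.

Lemma bop_contraction f x : `|f| <= 1 -> `|f x| <= `|x|.
Proof. by move=> f1; rewrite (le_trans (bop_le _ _))// ler_piMl. Qed.

End bounded_operator_algebra.

(** * Real inner products and the Cauchy-Schwarz inequality *)

Section inner_product.
Context (R : realType) (H : hilbertType R).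
Implicit Types u v w x y : H.

Lemma innerZr (a : R) u v : inner u (a *: v) = a * inner u v.
Proof. by rewrite innerC innerZl (innerC u). Qed.

Lemma inner0l u : inner 0 u = 0.
Proof. by rewrite -(scale0r (0 : H)) innerZl mul0r. Qed.

Lemma inner0r u : inner u 0 = 0.
Proof. by rewrite innerC inner0l. Qed.

Lemma innerBl u v w : inner (u - v) w = inner u w - inner v w.
Proof. by rewrite innerDl -scaleN1r innerZl mulN1r. Qed.

Lemma inner_suml I (r : seq I) (P : pred I) (F : I -> H) u :
  inner (\sum_(i <- r | P i) F i) u = \sum_(i <- r | P i) inner (F i) u.
Proof.
by apply: (big_morph (fun w => inner w u)) => [v w|]; rewrite ?innerDl ?inner0l.
Qed.

Lemma inner_ge0 u : 0 <= inner u u.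
Proof. by rewrite inner_norm sqr_ge0. Qed.

Lemma cauchy_schwarz u v : `|inner u v| <= `|u| * `|v|.
Proof.
rewrite -ler_sqr ?nnegrE ?mulr_ge0// real_normK ?num_real// exprMn -!inner_norm.
apply: form_cauchy_schwarz; [exact: innerC|exact: innerDl|exact: innerZl|].
exact: inner_ge0.
Qed.

Lemma normB_sqr u v : `|u - v| ^+ 2 = `|u| ^+ 2 - 2 * inner u v + `|v| ^+ 2.
Proof.
rewrite -!inner_norm innerBl !(innerC _ (_ - _)) !innerBl (innerC v u); ring.
Qed.

End inner_product.

(** * Variational construction of one eigenvector *)

Lemma eventually_invn_lt (R : realType) (e : R) : 0 < e ->
  exists N, forall n, (N <= n)%N -> n.+1%:R^-1 < e.
Proof.
move=> e0; exists (Num.truncn e^-1) => n nN.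
rewrite invf_plt ?posrE// (lt_le_trans (truncnS_gt _))// ler_nat ltnS//.
Qed.

Section maximal_eigenvector.
Context (R : realType) (H : hilbertType R) (E : bop H H).
Hypothesis E_compact : compact_operator E.
Hypothesis E_positive : positive_operator E.
Variable s : seq H.
Hypothesis s_eigen : forall v, v \in s -> exists mu : R, E v = mu *: v.

(** The orthogonal complement of the eigenvectors already found; it is invariant under [E] because
    [E] is symmetric. *)
Let W := [set x : H | forall v, v \in s -> inner x v = 0].
Let rayleigh := [set inner (E x) x | x in [set x | W x /\ `|x| <= 1]].

Let E_invariant x : W x -> W (E x).
Proof.
move=> Wx v vs; rewrite E_positive.1; have [mu ->] := s_eigen vs.
by rewrite innerZr Wx// mulr0.
Qed.

Let WZ (a : R) x : W x -> W (a *: x).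
Proof. by move=> Wx v vs; rewrite innerZl Wx// mulr0. Qed.

Let E_le x : `|E x| <= `|E| * `|x|.
Proof. exact: bop_le. Qed.

Let rayleigh_has_sup : has_sup rayleigh.
Proof.
split.
  by exists (inner (E 0) 0), 0 => //; split=> [v _|]; rewrite ?inner0l ?normr0.
exists `|E| => _ [x [_ x1] <-].
apply: le_trans (ler_norm _) _; apply: le_trans (cauchy_schwarz _ _) _.
apply: (@le_trans _ _ (`|E x| * 1)); first by rewrite ler_wpM2l.
by rewrite mulr1 (le_trans (E_le x))// ler_piMr.
Qed.

Let m := sup rayleigh.

Let inner_le x : W x -> inner (E x) x <= m * `|x| ^+ 2.
Proof.
move=> Wx; have [->|x0] := eqVneq x 0.
  by rewrite inner0r normr0 expr0n mulr0.
have nx0 : 0 < `|x| by rewrite normr_gt0.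
rewrite -ler_pdivrMr ?exprn_gt0//.
apply: (sup_upper_bound rayleigh_has_sup).
exists (`|x|^-1 *: x).
  split; first exact: WZ.
  by rewrite normrZ ger0_norm ?invr_ge0// mulVf// gt_eqF.
by rewrite linearZ innerZl innerZr expr2 invfM mulrA mulrC mulrA.
Qed.

Let m_ge0 : 0 <= m.
Proof.
apply: (sup_upper_bound rayleigh_has_sup); exists 0; last by rewrite inner0r.
by split=> [v _|]; rewrite ?inner0l ?normr0.
Qed.

(* Cauchy-Schwarz for the positive form <E x, y>, applied to x and E x. *)
Let norm_le x : W x -> `|E x| <= m * `|x|.
Proof.
move=> Wx.
have [->|Ex0] := eqVneq (E x) 0; first by rewrite normr0 mulr_ge0.
have nEx : 0 < `|E x| by rewrite normr_gt0.
have cs : inner (E x) (E x) ^+ 2 <= inner (E x) x * inner (E (E x)) (E x).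
  apply: (@form_cauchy_schwarz _ _ (fun x y => inner (E x) y)).
  - by move=> u v; rewrite E_positive.1 innerC.
  - by move=> u v w; rewrite linearD innerDl.
  - by move=> a u v; rewrite linearZ innerZl.
  - exact: E_positive.2.
rewrite -ler_sqr ?nnegrE ?mulr_ge0// -(ler_pM2r (exprn_gt0 2 nEx)).
rewrite -{1 2}inner_norm -expr2 (le_trans cs)//.
rewrite [leRHS](_ : _ = (m * `|x| ^+ 2) * (m * `|E x| ^+ 2)); last by ring.
apply: ler_pM; [exact: E_positive.2|exact: E_positive.2|exact: inner_le|].
by apply: inner_le; exact: E_invariant.
Qed.

(* A maximizing sequence [x_ n] of the Rayleigh quotient satisfies
   [E (x_ n) - m x_ n --> 0]; compactness gives a cluster point of [E (x_ n)]. *)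
Let maximizer : 0 < m -> exists u, [/\ W u, `|u| = 1 & E u = m *: u].
Proof.
move=> m0.
have /choice[x_ x_P] (n : nat) : exists x,
    [/\ W x, `|x| <= 1 & m - n.+1%:R^-1 < inner (E x) x].
  have [|_ [x [Wx x1] <-] xm] := sup_adherent (eps := n.+1%:R^-1) _ rayleigh_has_sup.
    by rewrite invr_gt0 ltr0Sn.
  by exists x.
have [y [_ ycl]] : closure (E @` [set x : H | `|x| <= 1])
    `&` cluster ((fun n => E (x_ n)) @ \oo) !=set0.
  apply: E_compact; exists 0%N => // n _; apply: subset_closure.
  by exists (x_ n) => //=; have [] := x_P n.
have x_y (e : R) : 0 < e -> exists n,
    [/\ `|E (x_ n) - y| <= e, `|E (x_ n) - m *: x_ n| <= e & m - e <= `|E (x_ n)|].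
  move=> e0.
  (* Expanding the square gives [|E x - m x|^2 <= 2 m^2 - 2 m <E x, x> < 2 m / (n + 1)], which the
     second term of the minimum pushes below [e^2]. *)
  have [N NP] : exists N, forall n, (N <= n)%N ->
      n.+1%:R^-1 < Num.min e (e ^+ 2 / (2 * m)).
    by apply: eventually_invn_lt; rewrite lt_min e0 divr_gt0 ?exprn_gt0// mulr_gt0.
  have [_ [[n /= Nn <-] yn]] : [set E (x_ n) | n in [set n | (N <= n)%N]]
      `&` ball y e !=set0.
    apply: ycl; last exact: nbhsx_ballx.
    by exists N => // n /= Nn; exists n.
  have [Wn xn1 xnm] := x_P n.
  have := NP n Nn; rewrite lt_min => /andP[ne ne2].
  exists n; split.
  - by move: yn; rewrite -ball_normE /= distrC => /ltW.
  - rewrite -ler_sqr ?nnegrE ?normr_ge0 ?(ltW e0)//.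
    rewrite normB_sqr innerZr normrZ (gtr0_norm m0) exprMn.
    have : `|E (x_ n)| ^+ 2 <= m ^+ 2.
      rewrite ler_sqr ?nnegrE//; apply: le_trans (norm_le Wn) _.
      by rewrite ler_piMr.
    have : m ^+ 2 * `|x_ n| ^+ 2 <= m ^+ 2.
      by rewrite ler_piMr ?sqr_ge0// expr_le1.
    rewrite ltr_pdivlMr ?mulr_gt0// in ne2.
    have : 2 * m * (m - n.+1%:R^-1) < 2 * m * inner (E (x_ n)) (x_ n).
      by rewrite ltr_pM2l// mulr_gt0.
    move: ne2; rewrite mulrBr; set k := n.+1%:R^-1; set ie := inner _ _.
    by rewrite -mulrA (mulrC k); nra.
  - apply: (@le_trans _ _ (inner (E (x_ n)) (x_ n))).
      by rewrite (le_trans _ (ltW xnm))// lerB// ltW.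
    apply: le_trans (ler_norm _) _; apply: le_trans (cauchy_schwarz _ _) _.
    by rewrite ler_piMr.
have small (a k : R) : 0 <= k -> (forall e : R, 0 < e -> a <= k * e) -> a <= 0.
  move=> k0 ae; rewrite leNgt; apply/negP => a0.
  have := ae (a / (k + 1)) (divr_gt0 a0 (ltr_wpDl k0 ltr01)).
  rewrite leNgt => /negP; apply.
  rewrite mulrA ltr_pdivrMr ?ltr_wpDl// mulrC ltr_pM2l//; lra.
have my (e : R) n : `|E (x_ n) - y| <= e -> `|E (x_ n) - m *: x_ n| <= e ->
    `|y - m *: x_ n| <= 2 * e.
  move=> ye me; rewrite [y - _](_ : _ = (E (x_ n) - m *: x_ n) - (E (x_ n) - y)).
    by rewrite (le_trans (ler_normB _ _))// mulr2n mulrDl mul1r lerD.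
  by rewrite opprB [RHS]addrC subrKA.
have Ey : E y = m *: y.
  apply/eqP; rewrite -subr_eq0 -normr_le0.
  apply: (small _ (`|E| * 2 + m)) => [|e e0]; first by rewrite addr_ge0// mulr_ge0.
  have [n [ye me _]] := x_y e e0.
  rewrite [E y - _](_ : _ = E (y - m *: x_ n) + m *: (E (x_ n) - y)).
    rewrite (le_trans (ler_normD _ _))// mulrDl lerD//.
      by rewrite (le_trans (E_le _))// -mulrA ler_wpM2l// my.
    by rewrite normrZ (gtr0_norm m0) ler_wpM2l// ltW.
  by rewrite bopB bopZ scalerBr subrKA.
have Wy : W y.
  move=> v vs; apply/eqP; rewrite -normr_le0.
  apply: (small _ (2 * `|v|)) => [|e e0]; first by rewrite mulr_ge0.
  have [n [ye me _]] := x_y e e0; have [Wn _ _] := x_P n.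
  rewrite -[y](subrK (m *: x_ n)) innerDl innerZl Wn// mulr0 addr0.
  by rewrite (le_trans (cauchy_schwarz _ _))// mulrAC ler_wpM2r// my.
have ny : 0 < `|y|.
  (* With [e = m / 4], [|E (x_ n)| >= 3 m / 4] and the distance to [y] is at most [m / 4], so
     [|y| >= m / 2]. *)
  have e0 : 0 < m / 4 by rewrite divr_gt0.
  have [n [ye _ mE]] := x_y _ e0.
  have := ler_normD (E (x_ n) - y) y; rewrite subrK; lra.
exists (`|y|^-1 *: y); split; first exact: WZ.
  by rewrite normrZ ger0_norm ?invr_ge0// mulVf// gt_eqF.
by rewrite bopZ Ey !scalerA mulrC.
Qed.

(** For [m > 0] the pair is a maximizer of the Rayleigh quotient on [W] with its value [m]. For
    [m = 0] the operator vanishes on [W], and the pair (0, 0) serves. *)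
Lemma exists_maximal_eigenvector : exists um : H * R,
  [/\ E um.1 = um.2 *: um.1,
      forall v, v \in s -> inner um.1 v = 0,
      `|um.1| = (0 < um.2)%R%:R, 0 <= um.2 &
      forall x, (forall v, v \in s -> inner x v = 0) ->
        `|E x| <= um.2 * `|x|].
Proof.
have [m0|] := ltP 0 m.
  by have [u [Wu u1 Eu]] := maximizer m0; exists (u, m); rewrite /= m0.
move=> m_le0; have m0 : m = 0 by apply/le_anti; rewrite m_le0 m_ge0.
exists (0, 0) => /=; rewrite linear0 scaler0 normr0 ltxx; split=> // [v _|x Wx].
  exact: inner0l.
by rewrite -m0; exact: norm_le.
Qed.

End maximal_eigenvector.

(** * Orthogonal eigenvectors by deflation *)

Section eigenvectors.
Context (R : realType) (H : hilbertType R) (E : bop H H).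
Hypothesis E_compact : compact_operator E.
Hypothesis E_positive : positive_operator E.

(* When [E] has only [n] positive eigenvalues, [v] and [mu] vanish from [n] on;
   this is why the [v n] are only required to be unit vectors or zero. *)
Lemma exists_eigenvectors : exists (v : nat -> H) (mu : nat -> R),
  [/\ forall n, E (v n) = mu n *: v n,
      forall i j, i != j -> inner (v i) (v j) = 0,
      forall n, `|v n| = (0 < mu n)%R%:R, forall n, 0 <= mu n &
      forall n x, (forall i, (i < n)%N -> inner x (v i) = 0) ->
        `|E x| <= mu n * `|x|].
Proof.
(* Guarding the properties by the eigenvector condition makes [step] a total function on lists, fit
   for iteration; [st_eigen] discharges the guard along the lists [st n]. *)
have /choice[step stepP] (s : seq H) : exists um : H * R,
    (forall v, v \in s -> exists mu : R, E v = mu *: v) ->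
    [/\ E um.1 = um.2 *: um.1,
        forall v, v \in s -> inner um.1 v = 0,
        `|um.1| = (0 < um.2)%R%:R, 0 <= um.2 &
        forall x, (forall v, v \in s -> inner x v = 0) ->
          `|E x| <= um.2 * `|x|].
  case: (pselect (forall v, v \in s -> exists mu : R, E v = mu *: v)) => sE.
    have [um umP] := exists_maximal_eigenvector E_compact E_positive sE.
    by exists um.
  by exists (0, 0).
pose st n := iter n (fun s => (step s).1 :: s) [::].
have stE n : st n.+1 = (step (st n)).1 :: st n by [].
have st_eigen n : forall v, v \in st n -> exists mu : R, E v = mu *: v.
  elim: n => [//|n IHn] v; rewrite stE inE => /orP[/eqP ->|]; last exact: IHn.
  by have [? _ _ _ _] := stepP _ IHn; eexists; eassumption.
have stP n := stepP _ (st_eigen n).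
have mem_st n w : reflect (exists2 i, (i < n)%N & w = (step (st i)).1) (w \in st n).
  elim: n => [|n IHn]; first by apply: (iffP idP) => // -[].
  rewrite stE inE; apply: (iffP orP) => [[/eqP ->|/IHn[i ni ->]]|[i]].
  - by exists n.
  - by exists i => //; exact: ltnW.
  - rewrite ltnS leq_eqVlt => /orP[/eqP -> ->|ni wE]; first by left.
    by right; apply/IHn; exists i.
have orth i j : (i < j)%N -> inner (step (st j)).1 (step (st i)).1 = 0.
  by move=> ij; have [_ + _ _ _] := stP j; apply; apply/mem_st; exists i.
exists (fun n => (step (st n)).1), (fun n => (step (st n)).2); split.
- by move=> n; have [] := stP n.
- by move=> i j; rewrite neq_ltn => /orP[]/orth//; rewrite innerC.
- by move=> n; have [] := stP n.
- by move=> n; have [] := stP n.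
- move=> n x xv; have [_ _ _ _] := stP n; apply => _ /mem_st[i ni ->].
  exact: xv.
Qed.

End eigenvectors.

(** * Decay of the ordered eigenvalues *)

Section eigenvalue_decay.
Context (R : realType) (H : hilbertType R) (E : bop H H).
Variables (v : nat -> H) (mu : nat -> R).
Hypothesis v_eigen : forall n, E (v n) = mu n *: v n.
Hypothesis v_orth : forall i j, i != j -> inner (v i) (v j) = 0.
Hypothesis v_norm : forall n, `|v n| = (0 < mu n)%R%:R.
Hypothesis mu_ge0 : forall n, 0 <= mu n.
Hypothesis mu_max : forall n x, (forall i, (i < n)%N -> inner x (v i) = 0) ->
  `|E x| <= mu n * `|x|.

(** The vector [v n] is orthogonal to all [v j] with [j < i], so the bound [mu_max] at [i] applies
    to it. *)
Lemma mu_nonincreasing i n : (i <= n)%N -> mu n <= mu i.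
Proof.
move=> lein; have [n0|] := ltP 0 (mu n); last by move/le_trans; apply.
have := @mu_max i (v n); rewrite v_eigen normrZ v_norm n0 !mulr1 ger0_norm//.
by apply => j ji; rewrite v_orth// gtn_eqF// (leq_trans ji).
Qed.

Variable lam : nat -> R.
Hypothesis lam_eigen : eigenvalue_sequence E lam.

(** For each value [m], the [v i] with [mu i = m] are orthonormal, hence independent, and the
    multiplicity condition yields as many distinct positions of [m] in [lam]. Positions of different
    values cannot collide, so these injections glue together. *)
Let mu_index n : 0 < mu n -> exists f : 'I_n.+1 -> nat,
  injective f /\ forall i, lam (f i) = mu i.
Proof.
move=> n0; have mu_gt0 (i : 'I_n.+1) : 0 < mu i.
  by rewrite (lt_le_trans n0)// mu_nonincreasing// -ltnS.
have /choice[F FP] (m : R) : exists f : 'I_n.+1 -> nat, m != 0 ->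
    {in [set i | mu (nat_of_ord i) == m]%SET &, injective f} /\
    {in [set i | mu (nat_of_ord i) == m]%SET, forall i, lam (f i) = m}.
  set S := [set i | _]%SET.
  have [->|m0] := eqVneq m 0; first by exists (fun=> 0%N).
  have [S0|[x0 x0S]] := set_0Vmem S.
    by exists (fun=> 0%N); rewrite S0; split=> i; rewrite inE.
  pose w (i : 'I_#|S|) : 'I_n.+1 := enum_val i.
  have [|j j_inj jm] := (lam_eigen #|S| m0).1.
    exists (fun i => v (w i)).
      move=> a av i.
      have := congr1 (fun u => inner u (v (w i))) av.
      rewrite inner_suml inner0l (bigD1 i)//= big1 => [|k ki]; last first.
        by rewrite innerZl v_orth ?mulr0// val_eqE (inj_eq enum_val_inj).
      by rewrite addr0 innerZl inner_norm v_norm mu_gt0 expr1n mulr1.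
    move=> i; rewrite v_eigen; have := enum_valP i.
    by rewrite inE => /eqP ->.
  exists (fun i => j (enum_rank_in x0S i)) => _; split=> [i k iS kS /j_inj|i iS].
    by move=> /(congr1 enum_val); rewrite !enum_rankK_in.
  exact: jm.
have FE i : lam (F (mu (nat_of_ord i)) i) = mu i.
  by have [_] := FP _ (lt0r_neq0 (mu_gt0 i)); apply; rewrite inE.
exists (fun i => F (mu (nat_of_ord i)) i); split=> // i k eqF.
have := FE k; rewrite -eqF FE => ik; rewrite ik in eqF.
by have [+ _] := FP _ (lt0r_neq0 (mu_gt0 k)); apply; rewrite ?inE ?ik.
Qed.

(* The [n.+1] largest eigenvalues occupy [n.+1] distinct positions in [lam],
   one of which is at least [n]. *)
Lemma mu_le_lam n : 0 < mu n -> exists2 k, (n <= k)%N & mu n <= lam k.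
Proof.
move=> n0; have [f [f_inj fE]] := mu_index n0.
have [i ni] : exists i, (n <= f i)%N.
  apply/existsP; apply: contraT; rewrite negb_exists => /forallP fn.
  have fn' i : (f i < n)%N by rewrite ltnNge.
  have /leq_card : injective (fun i => Ordinal (fn' i)).
    by move=> i k /(congr1 val)/= /f_inj.
  by rewrite !card_ord ltnn.
by exists (f i) => //; rewrite fE mu_nonincreasing// -ltnS.
Qed.

(** Although [lam] need not be sorted, its bound decreases in the index, so a position [k >= n] is
    enough. *)
Lemma mu_le_powR (c s : R) : 0 < c -> 0 < s ->
  (forall n, lam n <= c * n.+1%:R `^ (- s)) ->
  forall n, mu n <= c * n.+1%:R `^ (- s).
Proof.
move=> c0 s0 lam_le n.
have [n0|] := ltP 0 (mu n); last first.
  by move/le_trans; apply; rewrite mulr_ge0 ?powR_ge0// ltW.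
have [k nk /le_trans] := mu_le_lam n0; apply.
apply: le_trans (lam_le k) _; rewrite ler_pM2l// !powRN lef_pV2 ?posrE ?powR_gt0//.
by rewrite ge0_ler_powR ?nnegrE ?ler_nat// ltW.
Qed.

End eigenvalue_decay.

(** * Finite covers by closed balls *)

Section covers.
Context (R : realType) (V : normedModType R).
Implicit Types A B : set V.

(** Closed balls allow radius 0, which the empty sum in [covers_sum] requires. *)
Definition covers A (n : nat) (r : R) := exists2 cs : seq V,
  (size cs <= n)%N & forall x, A x -> exists2 y, y \in cs & `|x - y| <= r.

Lemma covers_le A n m (r t : R) : (n <= m)%N -> r <= t ->
  covers A n r -> covers A m t.
Proof.
move=> nm rt [cs csn csP]; exists cs; first exact: leq_trans nm.
by move=> x /csP[y ycs xy]; exists y => //; exact: le_trans rt.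
Qed.

Lemma covers_enlarge A B n (r t : R) :
  (forall x, B x -> exists2 y, A y & `|x - y| <= t) ->
  covers A n r -> covers B n (r + t).
Proof.
move=> BA [cs csn csP]; exists cs => // x /BA[y /csP[z zcs yz] xy].
exists z => //; rewrite -(subrKA y) (le_trans (ler_normD _ _))//.
by rewrite addrC lerD.
Qed.

(** Sums of centers serve as centers: counts multiply and radii add. The weights [k i] let the lemma
    be nested, a term of weight [k i] being itself a sum of [k i] elementary terms. *)
Lemma covers_sum (I : eqType) (s : seq I) (A : I -> set V) (k : I -> nat)
    (M : nat) (r : R) :
  (forall i, i \in s -> covers (A i) (M ^ k i) (r *+ k i)) ->
  covers [set \sum_(i <- s) f i | f in [set f | forall i, i \in s -> A i (f i)]]
    (M ^ \sum_(i <- s) k i) (r *+ \sum_(i <- s) k i).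
Proof.
elim: s => [_|i s IHs iAs].
  exists [:: 0]; rewrite ?big_nil// => _ [f _ <-]; exists 0; first by rewrite inE.
  by rewrite big_nil subrr normr0.
have [cs csn csP] := iAs i (mem_head _ _).
have [ds dsn dsP] := IHs (fun j js => iAs j (mem_behead (s := i :: s) js)).
exists [seq x + y | x <- cs, y <- ds].
  by rewrite size_allpairs big_cons expnD leq_mul.
move=> _ [f fA <-]; rewrite !big_cons mulrnDr.
have [x xcs fx] := csP (f i) (fA i (mem_head _ _)).
have [|y yds fy] := dsP (\sum_(j <- s) f j).
  by exists f => // j js; apply: fA; rewrite inE js orbT.
exists (x + y); first exact: allpairs_f.
by rewrite opprD addrACA (le_trans (ler_normD _ _))// lerD.
Qed.

Lemma covers_segment (w : V) (m : nat) : (0 < m)%N -> `|w| <= 1 ->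
  covers [set t *: w | t in [set t : R | `|t| <= 1]] m.+1 (2 / m%:R).
Proof.
move=> m0 w1; have m0' : 0 < m%:R :> R by rewrite ltr0n.
exists [seq (2 / m%:R * k%:R - 1) *: w | k <- iota 0 m.+1].
  by rewrite size_map size_iota.
move=> _ [t t1 <-]; have : `|t| <= 1 by []; rewrite ler_norml => /andP[tN1 tp1].
(* Rescales [[-1, 1]] to [[0, m]], where rounding down to an integer costs at most 1. *)
pose u := (t + 1) * (m%:R / 2).
have u0 : 0 <= u by rewrite mulr_ge0 ?divr_ge0// -lerBlDr sub0r.
have [ku uk] := andP (truncn_itv u0).
exists ((2 / m%:R * (truncn u)%:R - 1) *: w).
  apply/mapP; exists (truncn u) => //; rewrite mem_iota /= ltnS.
  rewrite -(ler_nat R) (le_trans ku)//.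
  by rewrite /u; nra.
rewrite -scalerBl normrZ (le_trans (ler_piMr _ w1))//.
have -> : t - (2 / m%:R * (truncn u)%:R - 1) = 2 / m%:R * (u - (truncn u)%:R).
  by rewrite /u; field; rewrite gt_eqF.
rewrite normrM ger0_norm ?divr_ge0// ler_piMr ?divr_ge0//.
by rewrite ger0_norm ?subr_ge0// lerBlDl natr1 ltW.
Qed.

End covers.

(** * Rank-one operators *)

Section rank_one.
Context (R : realType) (H : hilbertType R).

Lemma rank_one_subproof (v w : H) :
  (fun x => inner x v *: w) \in @bounded_linear R H H.
Proof.
apply/bounded_linearP; split.
  by move=> a x y; rewrite innerDl innerZl scalerDl scalerA.
exists (`|v| * `|w|) => x.
by rewrite normrZ mulrAC ler_wpM2r// mulrC cauchy_schwarz.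
Qed.

(** For nonzero eigenvectors, [rank_one (v j) (v i)] is the matrix unit of row [i] and column
    [j]. *)
Definition rank_one (v w : H) : bop H H := Bop (rank_one_subproof v w).

Lemma rank_one_norm (v w : H) : `|rank_one v w| <= `|v| * `|w|.
Proof.
apply: opnorm_le => x x1 /=; rewrite normrZ ler_wpM2r//.
by rewrite (le_trans (cauchy_schwarz _ _))// ler_piMl.
Qed.

End rank_one.

(** * Truncation of [ETE] to dyadic blocks of its matrix *)

Section truncation.
Context (R : realType) (H : hilbertType R) (E : bop H H).
Variables (v : nat -> H) (mu : nat -> R).
Hypothesis E_sym : forall x y, inner (E x) y = inner x (E y).
Hypothesis E_norm : `|E| <= 1.
Hypothesis v_eigen : forall n, E (v n) = mu n *: v n.
Hypothesis v_orth : forall i j, i != j -> inner (v i) (v j) = 0.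
Hypothesis v_norm : forall n, `|v n| = (0 < mu n)%R%:R.
Hypothesis mu_ge0 : forall n, 0 <= mu n.
Hypothesis mu_max : forall n x, (forall i, (i < n)%N -> inner x (v i) = 0) ->
  `|E x| <= mu n * `|x|.

(** The orthogonal projection onto the span of the [v i] with [n <= i < n']; vanishing [v i]
    contribute nothing. *)
Definition block_proj (n n' : nat) : bop H H :=
  \sum_(n <= i < n') rank_one (v i) (v i).

Lemma block_projE n n' x :
  block_proj n n' x = \sum_(n <= i < n') inner x (v i) *: v i.
Proof. exact: sum_bopE. Qed.

Lemma inner_self_eigenvector x j : inner x (v j) * inner (v j) (v j) = inner x (v j).
Proof.
have := v_norm j; rewrite inner_norm => vj; have := vj; case: ltP => _ vj'.
  by rewrite vj' expr1n mulr1.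
by move/normr0_eq0: vj' => ->; rewrite inner0r mul0r.
Qed.

Lemma block_proj_inner n n' x j :
  inner (block_proj n n' x) (v j) = if (n <= j < n')%N then inner x (v j) else 0.
Proof.
rewrite block_projE inner_suml; case: ifP => jn.
  rewrite (bigD1_seq j) ?mem_index_iota ?iota_uniq//= innerZl inner_self_eigenvector.
  by rewrite big1 ?addr0// => i ij; rewrite innerZl v_orth ?mulr0.
rewrite big_nat big1// => i iP; rewrite innerZl v_orth ?mulr0//.
by apply: contraFneq jn => <-.
Qed.

Lemma block_proj_sqr n n' x :
  `|block_proj n n' x| ^+ 2 = inner x (block_proj n n' x).
Proof.
rewrite -inner_norm {1}block_projE inner_suml (innerC x) {2}block_projE inner_suml.
rewrite big_nat [RHS]big_nat; apply: eq_bigr => i iP.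
by rewrite !innerZl (innerC (v i)) block_proj_inner iP (innerC (v i)).
Qed.

Lemma block_proj_norm n n' x : `|block_proj n n' x| <= `|x|.
Proof.
have [->|D0] := eqVneq (block_proj n n' x) 0; first by rewrite normr0.
rewrite -(@ler_pM2r _ `|block_proj n n' x|) ?normr_gt0// -expr2 block_proj_sqr.
by rewrite (le_trans (ler_norm _))// cauchy_schwarz.
Qed.

(** The remainder is orthogonal to the first [n] eigenvectors and no longer than [x], so [mu_max]
    applies. *)
Lemma tail_norm n x : `|E (x - block_proj 0 n x)| <= mu n * `|x|.
Proof.
have := @mu_max n (x - block_proj 0 n x); move=> /(_ _)/le_trans; apply.
  by move=> i ni; rewrite innerBl block_proj_inner ni subrr.
rewrite ler_wpM2l// -ler_sqr ?nnegrE// normB_sqr -block_proj_sqr.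
have := sqr_ge0 `|block_proj 0 n x|; lra.
Qed.

Lemma tail_commute n x : E x - block_proj 0 n (E x) = E (x - block_proj 0 n x).
Proof.
rewrite bopB !block_projE bop_sum; congr (_ - _); apply: eq_bigr => i _.
by rewrite bopZ v_eigen E_sym v_eigen innerZr scalerA mulrC.
Qed.

(** The block annihilates the components below [n], so [E x] may be replaced by its tail, which
    [tail_norm] controls. *)
Lemma block_norm n n' x : `|block_proj n n' (E x)| <= mu n * `|x|.
Proof.
apply: le_trans (tail_norm n x); rewrite -tail_commute.
apply: le_trans (block_proj_norm n n' _); rewrite le_eqVlt; apply/orP; left.
apply/eqP; congr (`|_|); rewrite bopB -[LHS]subr0; congr (_ - _).
rewrite [RHS]block_projE big_nat big1// => i /andP[ni _].
by rewrite block_proj_inner (ltnNge i) ni scale0r.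
Qed.

(** Subtracting one starts the first block at index 0 and turns [n.+1] in the eigenvalue bound into
    [2 ^ a]. *)
Let block_start a := (2 ^ a).-1.

Let block_start_le a : (block_start a <= block_start a.+1)%N.
Proof. by rewrite /block_start -!subn1 leq_sub2r// leq_exp2l. Qed.

Lemma sum_block_proj L x :
  \sum_(0 <= a < L) block_proj (block_start a) (block_start a.+1) x =
  block_proj 0 (block_start L) x.
Proof.
elim: L => [|L IHL]; first by rewrite big_geq// block_projE big_geq.
by rewrite big_nat_recr//= IHL !block_projE -big_cat_nat ?block_start_le.
Qed.

Section sandwich.
Variable T : bop H H.
Hypothesis T_norm : `|T| <= 1.
Let K := bop_comp E (bop_comp T E).

Definition truncated_sandwich L : bop H H :=
  \sum_(0 <= a < L) \sum_(block_start a <= i < block_start a.+1)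
    \sum_(0 <= j < block_start (L - a)) inner (K (v j)) (v i) *: rank_one (v j) (v i).

Let truncated_sandwichE L x : truncated_sandwich L x =
  \sum_(0 <= a < L) block_proj (block_start a) (block_start a.+1)
                      (K (block_proj 0 (block_start (L - a)) x)).
Proof.
rewrite sum_bopE; apply: eq_bigr => a _.
rewrite sum_bopE block_projE; apply: eq_bigr => i _.
rewrite sum_bopE block_projE bop_sum inner_suml scaler_suml; apply: eq_bigr => j _.
by rewrite bopZ innerZl -scalerA [LHS]scalerA mulrC scalerA.
Qed.

(** The error consists of the rows beyond block [L] and, for each row block [a], the columns from
    [block_start (L - a)] on. In the latter the left factor [E] contributes [mu (block_start a)] and
    the right one [mu (block_start (L - a))]. *)
Lemma truncated_sandwich_dist L :
  `|K - truncated_sandwich L| <=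
  mu (block_start L) + \sum_(0 <= a < L) mu (block_start a) * mu (block_start (L - a)).
Proof.
apply: opnorm_le => x x1.
have -> : (K - truncated_sandwich L) x = (K x - block_proj 0 (block_start L) (K x)) +
  \sum_(0 <= a < L) block_proj (block_start a) (block_start a.+1)
    (K (x - block_proj 0 (block_start (L - a)) x)).
  rewrite -sum_block_proj -[LHS]/(K x - truncated_sandwich L x) truncated_sandwichE.
  rewrite [X in _ = _ + X](eq_bigr _ (fun a _ => congr1 _ (bopB K _ _))).
  by rewrite [X in _ = _ + X](eq_bigr _ (fun a _ => bopB _ _ _)) sumrB subrKA.
apply: le_trans (ler_normD _ _) _; apply: lerD.
  rewrite tail_commute (le_trans (tail_norm _ _))// ler_piMr//.
  by rewrite (le_trans (bop_contraction _ T_norm))//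
    (le_trans (bop_contraction _ E_norm)).
apply: le_trans (ler_norm_sum _ _ _) _; apply: ler_sum => a _.
apply: le_trans (block_norm _ _ _) _; rewrite ler_wpM2l//.
apply: le_trans (bop_contraction _ T_norm) _.
by apply: le_trans (tail_norm _ _) _; rewrite ler_piMr.
Qed.

End sandwich.

Lemma covers_sandwich L m : (0 < m)%N ->
  covers [set bop_comp E (bop_comp T E) | T in [set T : bop H H | `|T| <= 1]]
    (m.+1 ^ (L * 2 ^ L))
    ((2 / m%:R) *+ (L * 2 ^ L) +
     (mu (block_start L) +
      \sum_(0 <= a < L) mu (block_start a) * mu (block_start (L - a)))).
Proof.
move=> m0.
pose k := (\sum_(0 <= a < L) \sum_(block_start a <= i < block_start a.+1)
  \sum_(0 <= j < block_start (L - a)) 1)%N.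
(* Row block [a] has [2 ^ a] rows and fewer than [2 ^ (L - a)] retained columns. *)
have kL : (k <= L * 2 ^ L)%N.
  apply: (@leq_trans (\sum_(0 <= a < L) 2 ^ L)%N).
    rewrite /k big_nat [leqRHS]big_nat; apply: leq_sum => a /= aL.
    rewrite !sum_nat_const_nat muln1 subn0 -[X in (_ <= 2 ^ X)%N](subnKC (ltnW aL)).
    rewrite expnD leq_mul ?leq_pred//.
    by rewrite /block_start expnS; have := expn_gt0 2 a; lia.
  by rewrite sum_nat_const_nat subn0.
pose seg (i j : nat) :=
  [set t *: rank_one (v j) (v i) | t in [set t : R | `|t| <= 1]].
pose sum1 a i := [set \sum_(0 <= j < block_start (L - a)) f j | f in
  [set f | forall j, j \in index_iota 0 (block_start (L - a)) -> seg i j (f j)]].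
pose sum2 a := [set \sum_(block_start a <= i < block_start a.+1) f i | f in
  [set f | forall i, i \in index_iota (block_start a) (block_start a.+1) ->
    sum1 a i (f i)]].
have v_le1 n : `|v n| <= 1 by rewrite v_norm; case: ltP.
have cov : covers
    [set \sum_(0 <= a < L) f a | f in
      [set f | forall a, a \in index_iota 0 L -> sum2 a (f a)]]
    (m.+1 ^ k) ((2 / m%:R) *+ k).
  (* One application each for row blocks, rows and columns leaves a single entry. *)
  do 3! (apply: covers_sum => ? _).
  apply: covers_segment => //; apply: le_trans (rank_one_norm _ _) _.
  by rewrite mulr_ile1.
apply: covers_le (covers_enlarge _ cov); first by rewrite leq_pexp2l.
  by apply: lerD; [rewrite ler_wpMn2l// divr_ge0|exact: lexx].
move=> _ [T T1 <-]; exists (truncated_sandwich T L); last first.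
  exact: truncated_sandwich_dist.
eexists; last reflexivity.
move=> a _; eexists; last reflexivity.
move=> i _; eexists; last reflexivity.
move=> j _; eexists; last reflexivity.
(* Matrix entries lie in [[-1, 1]], since [ETE] is a contraction and [|v n| <= 1]. *)
rewrite /= (le_trans (cauchy_schwarz _ _))// mulr_ile1//.
do 3! (apply: le_trans (bop_contraction _ _) _ => //).
Qed.

End truncation.

(** * From covers to covering numbers *)

Section covering_number.
Context (R : realType) (V W : normedModType R).

Lemma covers_image (A : set V) (f : V -> W) n (r : R) :
  (forall x y, `|f x - f y| <= `|x - y|) -> covers A n r -> covers (f @` A) n r.
Proof.
move=> fL [cs csn csP]; exists (map f cs); first by rewrite size_map.
move=> _ [x /csP[y ycs xy] <-]; exists (f y); first exact: map_f.
exact: le_trans xy.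
Qed.

Lemma covering_number_ge0 (A : set V) (r : R) : (0 <= covering_number A r)%E.
Proof. by apply/ereal_infP => _ [n _ <-]; rewrite lee_fin ler0n. Qed.

(** The gap [t < r] fits closed balls of radius [t] into open balls of radius [r]. *)
Lemma covering_number_le (A : set V) n (t r : R) : t < r -> covers A n t ->
  (covering_number A r <= n%:R%:E)%E.
Proof.
move=> tr [cs csn csP]; apply: (@le_trans _ _ (size cs)%:R%:E); last first.
  by rewrite lee_fin ler_nat.
apply: ereal_inf_lbound; exists (size cs) => //.
exists (fun i => nth 0 cs i) => x /csP[y ycs xy].
have yi : (index y cs < size cs)%N by rewrite index_mem.
exists (Ordinal yi) => //=; rewrite -ball_normE /= nth_index// distrC.
exact: le_lt_trans tr.
Qed.

(** Counting in powers of two costs no constant, because [ln 2 <= 1]. *)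
Lemma lne_covering_number_le (A : set V) n (t r : R) : t < r ->
  covers A (2 ^ n) t -> (lne (covering_number A r) <= n%:R%:E)%E.
Proof.
move=> tr /(covering_number_le tr) le2n.
apply: (@le_trans _ _ (lne (2 ^ n)%:R%:E)).
  by rewrite lee_lne// in_itv/= ?covering_number_ge0 ?lee_fin ?ler0n ?leey.
rewrite lne_EFin ?ltr0n ?expn_gt0// lee_fin natrX lnXn// lerMn2r; apply/orP; right.
by apply: (@le_ln1Dx _ 1); lra.
Qed.

End covering_number.

(** * Linear against exponential growth *)

Section dyadic_growth.
Context (R : realType).

(** Follows from [1 + x <= exp x] at [x = d L ln 2]; it absorbs the factors polynomial in [L]. *)
Lemma nat_le_powR2 (d : R) : 0 < d ->
  exists2 D : R, 0 < D & forall L : nat, L%:R <= D * 2 `^ (d * L%:R).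
Proof.
move=> d0; have ln2 : 0 < ln (2 : R) by rewrite ln_gt0// ltr1n.
have dl : 0 < d * ln 2 by rewrite mulr_gt0.
exists (d * ln 2)^-1; first by rewrite invr_gt0.
move=> L; rewrite mulrC ler_pdivlMr// /powR pnatr_eq0/=.
apply: le_trans (expR_ge1Dx _); rewrite mulrC mulrAC; lra.
Qed.

End dyadic_growth.

(** * Entropy of the operators [ETE] *)

Section sandwich_entropy.
Context (R : realType) (H : hilbertType R) (E : bop H H).
Hypothesis E_compact : compact_operator E.
Hypothesis E_positive : positive_operator E.
Hypothesis E_norm : `|E| <= 1.
Variables (lam : nat -> R) (c s : R).
Hypothesis lam_eigen : eigenvalue_sequence E lam.
Hypothesis c_gt0 : 0 < c.
Hypothesis s_gt0 : 0 < s.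
Hypothesis lam_le : forall n : nat, lam n <= c * n.+1%:R `^ (- s).

Lemma covers_sandwich_dyadic (q L : nat) : s <= q%:R ->
  covers [set bop_comp E (bop_comp T E) | T in [set T : bop H H | `|T| <= 1]]
    (2 ^ ((q + 3) * L ^ 2 * 2 ^ L))
    ((c + 2 + c ^+ 2 * L%:R) * 2 `^ (- s * L%:R)).
Proof.
move=> sq.
have [v [mu [v_eigen v_orth v_norm mu_ge0 mu_max]]] :=
  exists_eigenvectors E_compact E_positive.
have mu_le2 a : mu (2 ^ a).-1 <= c * 2 `^ (- s * a%:R).
  have := mu_le_powR v_eigen v_orth v_norm mu_ge0 mu_max lam_eigen c_gt0 s_gt0
    lam_le (2 ^ a).-1.
  by rewrite prednK ?expn_gt0// natrX -powR_mulrn// -powRrM (mulrC a%:R).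
(* The rounding error [2 / m] summed over [L * 2 ^ L] entries is then at most
   [2 * 2^(-q L) <= 2 * 2^(-s L)]. *)
pose m := (L.+1 * 2 ^ L * 2 ^ (q * L))%N.
have m0 : (0 < m)%N by rewrite /m !muln_gt0 !expn_gt0.
apply: covers_le (covers_sandwich E_positive.1 E_norm v_eigen v_orth v_norm
  mu_ge0 mu_max L m0).
- have [->|L0] := posnP L; first by rewrite mul0n expn0 expn_gt0.
  rewrite (_ : (q + 3) * L ^ 2 * 2 ^ L = (q + 3) * L * (L * 2 ^ L))%N; last first.
    by rewrite -mulnn !mulnA.
  rewrite [leqRHS]expnM leq_exp2r ?muln_gt0 ?L0 ?expn_gt0//.
  (* The last three summands bound the factors of [m], using [L.+1 <= 2 ^ L]; the first pays for
     [m.+1 <= 2 * m], as [L > 0]. *)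
  rewrite (_ : (q + 3) * L = L + (L + (L + q * L)))%N; last by lia.
  rewrite expnD.
  have mP : (m <= 2 ^ (L + (L + q * L)))%N.
    by rewrite 2!expnD mulnA /m !leq_mul// ltn_expl.
  apply: (@leq_trans (2 * 2 ^ (L + (L + q * L)))); last first.
    by rewrite leq_mul2r -{2}(expn1 2) leq_exp2l// L0 orbT.
  by have := expn_gt0 2 (L + (L + q * L)); lia.
- set w := 2 `^ _.
  rewrite [leRHS](_ : _ = 2 * w + (c * w + c ^+ 2 * L%:R * w)); last by ring.
  rewrite /w; apply: lerD.
    rewrite -[_ *+ (L * _)]mulr_natr.
    have -> : 2 / m%:R * (L * 2 ^ L)%:R = 2 * (L%:R / L.+1%:R) / 2 ^+ (q * L) :> R.
      have pow2 n : (2 : R) ^+ n != 0 by rewrite expf_neq0.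
      rewrite /m !natrM !natrX; move: L.+1%:R (pnatr_eq0 R L.+1) => u /negbT u0.
      by field; rewrite !pow2 u0.
    rewrite -mulrA ler_pM2l// mulNr powRN.
    apply: (@le_trans _ _ (1 / 2 ^+ (q * L))).
      by rewrite ler_pM2r ?invr_gt0 ?exprn_gt0// ler_pdivrMr// mul1r ler_nat.
    rewrite mul1r lef_pV2 ?posrE ?exprn_gt0 ?powR_gt0//.
    by rewrite -powR_mulrn// natrM ler_powR ?ler1n// ler_wpM2r.
  apply: lerD; first exact: mu_le2.
  apply: (@le_trans _ _ (\sum_(0 <= a < L) c ^+ 2 * 2 `^ (- s * L%:R))).
    rewrite big_nat [leRHS]big_nat; apply: ler_sum => a /= aL.
    apply: le_trans (ler_pM (mu_ge0 _) (mu_ge0 _) (mu_le2 _) (mu_le2 _)) _.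
    rewrite mulrACA -expr2 -powRD ?pnatr_eq0 ?implybT//.
    by rewrite -mulrDr -natrD subnKC// ltnW.
  by rewrite sumr_const_nat subn0 -[_ *+ L]mulr_natr mulrAC.
Qed.
Lemma sandwich_entropy (s' : R) : 0 < s' -> s' < s ->
  exists2 C : R, 0 < C & forall r : R, 0 < r -> exists n t,
    [/\ covers [set bop_comp E (bop_comp T E) | T in [set T : bop H H | `|T| <= 1]]
           (2 ^ n) t, t < r & n%:R <= C * r `^ (- ((2 * s + 1) / (2 * s * s')))].
Proof.
move=> s'0 s's; set p := (2 * s + 1) / (2 * s * s').
have p0 : 0 < p by rewrite divr_gt0 ?addr_gt0 ?mulr_gt0.
pose q := (truncn s).+1.
have sq : s <= q%:R by rewrite ltW// truncnS_gt.
have ss' : 0 < s - s' by rewrite subr_gt0.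
have [D1 D1_gt0 D1P] := @nat_le_powR2 R _ ss'.
(* Squaring the bound on [L] yields [2^(L / (2 s))], exactly the surplus in
   [s' * p = 1 + 1 / (2 s)]. *)
have d2_gt0 : 0 < (4 * s)^-1 by rewrite invr_gt0 mulr_gt0.
have [D2 D2_gt0 D2P] := nat_le_powR2 d2_gt0.
have [D3 D3_gt0 D3P] := nat_le_powR2 s'0.
(* The 3 in place of the 2 of the cover radius makes [radius_lt] strict. *)
pose A := c + 3 + c ^+ 2 * D1.
have A0 : 0 < A by rewrite !addr_gt0// mulr_gt0 ?exprn_gt0.
have radius_lt (L : nat) :
    (c + 2 + c ^+ 2 * L%:R) * 2 `^ (- s * L%:R) < A * 2 `^ (- s' * L%:R).
  have w0 : 0 < 2 `^ ((s - s') * L%:R) :> R by rewrite powR_gt0.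
  have w1 : 1 <= 2 `^ ((s - s') * L%:R) :> R.
    by rewrite -[leLHS](powRr0 2) ler_powR ?ler1n// mulr_ge0// subr_ge0 ltW.
  have -> : - s' * L%:R = (s - s') * L%:R + - s * L%:R by ring.
  rewrite powRD ?pnatr_eq0 ?implybT// mulrA ltr_pM2r ?powR_gt0//.
  have := D1P L; have := exprn_gt0 2 c_gt0; move: w0 w1 c_gt0 D1_gt0.
  rewrite /A; set w := _ `^ _; set d := c ^+ 2; set l := L%:R => w0 w1 cp Dp dp lD.
  have : d * l <= d * (D1 * w) by rewrite ler_pM2l.
  nra.
pose B := (q + 3)%:R * D2 ^+ 2.
have B0 : 0 < B by rewrite mulr_gt0 ?exprn_gt0// ltr0n addn_gt0 orbT.
have count_le (L : nat) :
    ((q + 3) * L ^ 2 * 2 ^ L)%:R <= B * (2 `^ (s' * L%:R)) `^ p.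
  have -> : (2 `^ (s' * L%:R)) `^ p =
      (2 `^ ((4 * s)^-1 * L%:R)) ^+ 2 * 2 ^+ L :> R.
    rewrite -[in RHS]powR_mulrn ?powR_ge0// -[in RHS](powR_mulrn L)//.
    rewrite -!powRrM -powRD ?pnatr_eq0 ?implybT//; congr powR.
    by rewrite /p; field; rewrite ?gt_eqF.
  rewrite !natrM !natrX /B -mulrA [leRHS](_ : _ = (q + 3)%:R *
    ((D2 * 2 `^ ((4 * s)^-1 * L%:R)) ^+ 2 * 2 ^+ L)); last by ring.
  rewrite ler_pM2l ?ltr0n ?addn_gt0 ?orbT//.
  by rewrite ler_pM2r ?exprn_gt0// -expr2 ler_sqr ?nnegrE ?D2P// mulr_ge0 ?powR_ge0// ltW.
(* The factor [2^s'] is the loss from [L - 1] to [L]: for the least admissible [L > 0], [L - 1]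
   fails, so [2^(s' L) < 2^s' * A / r]. *)
exists (B * (2 `^ s' * A) `^ p); last move=> r r0.
  by rewrite mulr_gt0// powR_gt0// mulr_gt0// powR_gt0.
have radius_le (L : nat) :
    (A * 2 `^ (- s' * L%:R) <= r) = (A / r <= 2 `^ (s' * L%:R)).
  by rewrite mulNr powRN ler_pdivrMr ?powR_gt0// ler_pdivrMr// mulrC.
have exL : exists L : nat, A * 2 `^ (- s' * L%:R) <= r.
  exists (truncn (A / r * D3)).+1; rewrite radius_le -(ler_pM2r D3_gt0).
  by rewrite (le_trans (ltW (truncnS_gt _)))// [leRHS]mulrC.
have [L LP Lmin] := ex_minnP exL.
exists ((q + 3) * L ^ 2 * 2 ^ L)%N, ((c + 2 + c ^+ 2 * L%:R) * 2 `^ (- s * L%:R)).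
split; [exact: covers_sandwich_dyadic|exact: lt_le_trans (radius_lt L) LP|].
(* For [L = 0], which occurs for large [r], one ball suffices and the exponent is 0. *)
case: L => [|L] in LP Lmin *.
  by rewrite muln0 mul0n mulr_ge0 ?powR_ge0// mulr_ge0 ?powR_ge0// ltW.
have Lr : 2 `^ (s' * L%:R) < A / r.
  by rewrite ltNge -radius_le; apply/negP => /Lmin; rewrite ltnn.
apply: le_trans (count_le _) _; rewrite -mulrA ler_pM2l//.
rewrite -[- p]mulN1r (powRrM r) powR_inv1 ?(ltW r0)//.
have A2 : 0 <= 2 `^ s' * A by rewrite mulr_ge0 ?powR_ge0 ?ltW.
have rV0 : 0 <= r^-1 by rewrite invr_ge0 ltW.
rewrite -powRM//; apply: ge0_ler_powR; first exact: ltW.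
- by rewrite nnegrE powR_ge0.
- by rewrite nnegrE mulr_ge0.
have -> : s' * L.+1%:R = s' + s' * L%:R by rewrite -(natr1 L); ring.
by rewrite powRD ?pnatr_eq0 ?implybT// -[leRHS]mulrA ler_pM2l ?powR_gt0// ltW.
Qed.

End sandwich_entropy.

(** * Transfer to the operators [B0 (Id + K)] *)

Theorem proposition4p2 (R : realType)
  (X : hilbertType R) (X_separable : separable X)
  (B0 : bop (ell2 R) X) (B0_inj : injective B0) (B0_norm : `|B0| <= 1)
  (E : bop (ell2 R) (ell2 R)) (E_compact : compact_operator E)
  (E_positive : positive_operator E) (E_norm : `|E| <= 1)
  (lam : nat -> R) (lam_eigen : eigenvalue_sequence E lam)
  (c s : R) (c_gt0 : 0 < c) (s_gt0 : 0 < s)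
  (lam_le : forall n : nat, lam n <= c * n.+1%:R `^ (- s))
  (cI : {fset nat} -> R) (cI_gt0 : forall I, 0 < cI I)
  (s' : R) (s'_gt0 : 0 < s') (s'_lt : s' < s) :
  exists2 C : R, 0 < C & forall r : R, 0 < r ->
    (lne (covering_number (classB B0 E cI) r)
     <= (C * r `^ (- ((2 * s + 1) / (2 * s * s'))))%:E)%E.
Proof.
have [C C0 CP] := sandwich_entropy E_compact E_positive E_norm lam_eigen
  c_gt0 s_gt0 lam_le s'_gt0 s'_lt.
exists C => // r r0; have [n [t [cov tr nC]]] := CP r r0.
apply: (@le_trans _ _ n%:R%:E); last by rewrite lee_fin.
apply: (lne_covering_number_le tr).
(* The map from [K] to [B0 (Id + K)] is nonexpansive: the identity cancels in differences and
   [|B0| <= 1]. *)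
have B0_image : covers [set bop_comp B0 (bop_id _ + K) | K in
    [set bop_comp E (bop_comp T E) | T in [set T : bop _ _ | `|T| <= 1]]] (2 ^ n) t.
  apply: covers_image cov => K L; apply: opnorm_le => x x1.
  rewrite -[X in `|X|]/(B0 (x + K x) - B0 (x + L x)) -bopB opprD addrACA subrr add0r.
  rewrite (le_trans (bop_contraction _ B0_norm))// (le_trans (bop_le (K - L) x))//.
  by rewrite ler_piMr// opnorm_ge0.
have [cs csn csP] := B0_image; exists cs => // _ [K [T [-> T1 _]] <-].
by apply: csP; exists (bop_comp E (bop_comp T E)) => //; exists T.
Qed.
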